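(* There exist a universal constant $c>0$, an integer $N_0$, and two sequences $(S_n)_{n\ge N_0}$, $(S_n')_{n\ge N_0}$, where $S_n$ and $S_n'$ are sets of transpositions in the symmetric group $\mathfrak{S}_n$, each generating $\mathfrak{S}_n$, such that for all $n\ge N_0$: (i) the Cayley graphs $\mathrm{Cay}(\mathfrak{S}_n,S_n)$ and $\mathrm{Cay}(\mathfrak{S}_n,S_n')$ are $(3,0)$-quasi-isometric; (ii) $t_{\mathrm{mix}}(\mathrm{Cay}(\mathfrak{S}_n,S_n'))\ \ge\ c\; t_{\mathrm{mix}}(\mathrm{Cay}(\mathfrak{S}_n,S_n))\,\log\log\log|\mathfrak{S}_n|$; (iii) $S_n\subset S_n'\subset S_n^3$, where $S_n^3:=\{xyz:x,y,z\in S_n\}$.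
   Context: $\mathfrak{S}_n$ is the group of permutations of $n$ elements; a transposition exchanges two values and fixes the rest. For a finite group $\Gamma$ and a generating set $S$ with $S=S^{-1}$, $\mathrm{Cay}(\Gamma,S)$ is the graph with vertex set $\Gamma$ and edges $\{(g,gs):g\in\Gamma,s\in S\}$. For a graph $G$, $t_{\mathrm{mix}}(G)$ is the total variation mixing time of the discrete-time lazy simple random walk $(X_t)$ on $G$ (at each step it stays put with probability $1/2$, otherwise it moves to a uniformly chosen neighbour): with $\pi$ its stationary distribution, $$t_{\mathrm{mix}}=\max_x\inf\{t\ge 0:\|\mathbb{P}_x(X_t=\cdot)-\pi\|_{\mathrm{TV}}\le \tfrac14\},\qquad \|\mu-\nu\|_{\mathrm{TV}}=\tfrac12\sum_x|\mu(x)-\nu(x)|.$$ Two metric spaces $X,Y$ are $(a,b)$-quasi-isometric if there is a map $\phi:X\to Y$ with $\frac{d(u,v)-b}{a}\le d(\phi(u),\phi(v))\le a\,d(u,v)+b$ for all $u,v\in X$, and such that for every $y\in Y$ there is $x\in X$ with $d(\phi(x),y)\le a+b$. Graphs are viewed as metric spaces with the graph distance. The symbol $\subset$ does not exclude equality. *)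

(* Defs.v *)
From HB Require Import structures.
From mathcomp Require Import all_boot all_order all_algebra all_fingroup.
From mathcomp Require Import all_classical all_reals all_analysis.

Set Implicit Arguments.
Unset Strict Implicit.
Unset Printing Implicit Defensive.

Import Order.TTheory GRing.Theory Num.Theory.

Local Open Scope classical_set_scope.
Local Open Scope ring_scope.

Definition transposition (T : finType) (s : {perm T}) : Prop :=
  exists i j : T, i != j /\ s = tperm i j.

Definition generates (gT : finGroupType) (S : {set gT}) : Prop :=
  <<S>>%g = [set: gT]%SET.

(* A graph on T is given by its adjacency relation.  For a set S of
   involutions (such as transpositions) this relation is symmetric, and it is
   irreflexive as soon as 1 is not in S. *)
Definition cayley (gT : finGroupType) (S : {set gT}) : rel gT :=
  fun g h => [exists s in S, h == (g * s)%g].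

Section Metric.
Variable R : realType.

(* This is the graph distance for connected graphs; inf set0 = 0 is a junk
   value for a pair of vertices lying in distinct components. *)
Definition gdist (T : finType) (e : rel T) (x y : T) : R :=
  inf [set (size p)%:R | p in [set p : seq T | path e x p /\ last x p = y]].

Definition quasi_isometric (X Y : Type) (dX : X -> X -> R) (dY : Y -> Y -> R)
    (a b : R) : Prop :=
  exists phi : X -> Y,
    (forall u v, (dX u v - b) / a <= dY (phi u) (phi v) <= a * dX u v + b) /\
    (forall y, exists x, dY (phi x) y <= a + b).

End Metric.

Section LazyWalk.
Variables (R : realType) (T : finType) (e : rel T).

Definition degree (x : T) : nat := #|[set y | e x y]%SET|.

Definition lazy_kernel (x y : T) : R :=
  2^-1 * (x == y)%:R + 2^-1 * ((e x y)%:R / (degree x)%:R).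

(* walk_law x t is the distribution of X_t for the walk started at X_0 = x. *)
Fixpoint walk_law (x : T) (t : nat) : T -> R :=
  if t is t'.+1 then fun y => \sum_z walk_law x t' z * lazy_kernel z y
  else fun y => (x == y)%:R.

Definition is_stationary (p : T -> R) : Prop :=
  [/\ forall x, 0 <= p x,
      \sum_x p x = 1
    & forall y, \sum_x p x * lazy_kernel x y = p y].

(* The stationary distribution, which is unique when e is the adjacency
   relation of a connected graph; the zero function is a junk value. *)
Definition stationary : T -> R := xget (fun=> 0) [set p | is_stationary p].

Definition tv_dist (p q : T -> R) : R := 2^-1 * \sum_x `|p x - q x|.

(* Extended-real valued, so that the infimum over an empty set of times
   is +oo. *)
Definition tmix : \bar R :=
  \big[Order.max/-oo%E]_(x : T)
    ereal_inf [set t%:R%:E | t in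
      [set t : nat | tv_dist (walk_law x t) stationary <= 4^-1]].

End LazyWalk.

(* Main.v *)
Require Import Defs.
From HB Require Import structures.
From mathcomp Require Import all_boot all_order all_algebra all_fingroup.
From mathcomp Require Import all_classical all_reals all_analysis.
From mathcomp Require Import ring lra zify.

Set Implicit Arguments.
Unset Strict Implicit.
Unset Printing Implicit Defensive.

Import Order.TTheory GRing.Theory Num.Theory.

Local Open Scope ring_scope.

(* S is the star of the transpositions (h i), of cardinality n - 1, and S' adds
   to it all transpositions fixing a given leaf v.  A transposition (i j) is
   (h i)(h j)(h i), so the word metrics are comparable, but #|S'| is of order
   n^2.  The walk on S' moves v only by (h v), hence is not mixed before time
   #|S'| / 2.  The walk on S mixes in time O(n log n), here bounded by
   O(n^(3/2)): its law is a mixture of uniform laws on cosets g Sym(A), where a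
   state with h in A, upon drawing (h i) with i outside A, turns into one with
   #|A| unchanged and h outside A, and this one turns into the uniform law on
   g Sym(h |: A) upon drawing (h i) with i in A or, with the same weight as one
   of these, the identity.  A then grows by one element; other steps preserve
   the shape of the state. *)

(** * One step of the lazy walk on a Cayley graph, and its stationary law *)

Section CayleyWalk.
Variables (R : realType) (gT : finGroupType) (S : {set gT}).

Lemma cayleyE (x y : gT) : cayley S x y = (x^-1 * y \in S)%g.
Proof.
apply/exists_inP/idP => [[s sS /eqP ->]|xyS]; first by rewrite mulKg.
by exists (x^-1 * y)%g; rewrite ?mulKVg.
Qed.

Lemma degree_cayley (x : gT) : degree (cayley S) x = #|S|.
Proof.
rewrite /degree -[RHS](card_imset _ (mulgI x)).
apply: eq_card => y; rewrite inE cayleyE.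
apply/idP/imsetP => [xyS|[s sS ->]]; last by rewrite mulKg.
by exists (x^-1 * y)%g; rewrite ?mulKVg.
Qed.

Definition step (f : gT -> R) (y : gT) : R :=
  \sum_z f z * lazy_kernel R (cayley S) z y.

Lemma walk_law_step (x : gT) (t : nat) :
  walk_law R (cayley S) x t = iter t step (fun y => (x == y)%:R).
Proof. by elim: t => //= t ->. Qed.

Lemma stepE (f : gT -> R) (y : gT) :
  step f y = 2^-1 * f y + (2 * #|S|%:R)^-1 * \sum_(s in S) f (y * s^-1)%g.
Proof.
rewrite /step /lazy_kernel.
under eq_bigr do rewrite mulrDr.
rewrite big_split /=; congr (_ + _).
  rewrite (bigD1 y) //= eqxx mulr1 big1 ?addr0 ?(mulrC (f y)) // => z /negPf ->.
  by rewrite mulr0 mulr0.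
rewrite invfM mulr_sumr.
under eq_bigr do rewrite degree_cayley cayleyE.
rewrite (reindex_inj (h := fun s => (y * s^-1)%g)); last first.
  by move=> s t /mulgI /invg_inj.
rewrite [RHS]big_mkcond /=; apply: eq_bigr => s _.
rewrite invMg invgK -mulgA mulVg mulg1; case: (s \in S).
  by rewrite mul1r; ring.
by rewrite mul0r !mulr0.
Qed.

Lemma step_lin (a : R) (f g : gT -> R) :
  step (fun y => a * f y + g y) = fun y => a * step f y + step g y.
Proof.
apply/funext => y; rewrite /step mulr_sumr -big_split /=.
by apply: eq_bigr => z _; rewrite mulrDl mulrA.
Qed.

Hypothesis S_gt0 : (0 < #|S|)%N.

Let dS_neq0 : #|S|%:R != 0 :> R.
Proof. by rewrite pnatr_eq0 -lt0n. Qed.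

Lemma sum_step (f : gT -> R) : \sum_y step f y = \sum_y f y.
Proof.
under eq_bigr do rewrite stepE.
rewrite big_split /= -!mulr_sumr exchange_big /=.
have shift s : \sum_y f (y * s^-1)%g = \sum_y f y.
  by rewrite [RHS](reindex_inj (mulIg s^-1%g)).
rewrite (eq_bigr _ (fun s _ => shift s)).
rewrite sumr_const -[_ *+ #|_|]mulr_natl.
by field.
Qed.

Lemma step_ge0 (f : gT -> R) : (forall y, 0 <= f y) -> forall y, 0 <= step f y.
Proof.
move=> f0 y; rewrite stepE addr_ge0 // mulr_ge0 ?invr_ge0 ?mulr_ge0 //.
exact: sumr_ge0.
Qed.

Lemma walk_law_ge0 (x y : gT) (t : nat) : 0 <= walk_law R (cayley S) x t y.
Proof.
rewrite walk_law_step; elim: t y => [|t IH] y /=; first by case: (x == y).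
exact: step_ge0.
Qed.

Hypothesis S_gen : generates S.

(** Uniqueness is the maximum principle: the set of maximisers of a stationary law is invariant
    under the subgroup generated by [S], hence is the whole group. *)
Lemma stationary_cayley : stationary R (cayley S) = fun=> #|gT|%:R^-1.
Proof.
have gT_neq0 : #|gT|%:R != 0 :> R by rewrite pnatr_eq0 -lt0n; apply/card_gt0P; exists 1%g.
apply: xget_unique => [|p [p0 p1 pK]].
  split=> [x||y]; first by rewrite invr_ge0.
    by rewrite sumr_const -[_ *+ #|_|]mulr_natl mulfV.
  rewrite -/(step (fun=> _) y) stepE sumr_const -[_ *+ #|_|]mulr_natl.
  by field; rewrite dS_neq0 gT_neq0.
have {}pK y : step p y = p y by rewrite -[RHS]pK.
pose x := [arg max_(i > (1%g : gT)) p i]%O.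
have px_max y : p y <= p x by rewrite /x; case: arg_maxP => // i _; apply.
(* [H] consists of the z whose inverse, multiplied on the right, preserves the set of maximisers of
   [p]. *)
pose H := [set z | [forall y, (p y == p x) ==> (p (y * z^-1)%g == p x)]].
have HP z : reflect (forall y, p y = p x -> p (y * z^-1)%g = p x) (z \in H).
  rewrite inE; apply: (iffP forallP) => [Hz y py|Hz y].
    by apply/eqP/(implyP (Hz y))/eqP.
  by apply/implyP => /eqP py; apply/eqP/Hz.
have H_group : group_set H.
  apply/group_setP; split=> [|a b /HP Ha /HP Hb]; apply/HP => y py.
    by rewrite invg1 mulg1.
  by rewrite invMg mulgA; apply: Ha; apply: Hb.
have SH : (S \subset Group H_group)%g.
  apply/fintype.subsetP => s sS; apply/HP => y py; apply/eqP.
  move: (pK y); rewrite stepE py => E.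
  (* At a maximiser, stationarity makes the nonnegative deficits [p x - p (y * s^-1)] sum to 0, so
     each of them vanishes. *)
  have sumE : \sum_(s in S) (p x - p (y * s^-1)%g) = 0.
    rewrite sumrB sumr_const -[_ *+ #|_|]mulr_natl.
    move: E; set Z := \sum_(s in S) _ => E.
    have -> : Z = (2 * #|S|%:R) * ((2 * #|S|%:R)^-1 * Z) by field.
    have -> : (2 * #|S|%:R)^-1 * Z = 2^-1 * p x by lra.
    by field.
  have := psumr_eq0P _ sumE => H0.
  by rewrite eq_sym -subr_eq0 H0 // => i _; rewrite subr_ge0.
have HT z : z \in H.
  have : z \in <<S>>%g by rewrite S_gen inE.
  by move: SH; rewrite -gen_subG => /fintype.subsetP; apply.
apply/funext => y.
have p_const z : p z = p x.
  by have /HP/(_ x erefl) := HT (z^-1 * x)%g; rewrite invMg invgK mulKVg.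
move: p1; under eq_bigr do rewrite p_const.
rewrite sumr_const -[_ *+ #|_|]mulr_natl p_const => E.
by apply: (mulfI gT_neq0); rewrite E mulfV.
Qed.

End CayleyWalk.

(** * Cumulated distance to uniformity *)

Section Discrepancy.
Variables (R : realType) (gT : finGroupType) (S : {set gT}).

(** For a probability law this is twice the total variation distance to uniform. Subtracting the
    mean of [f] itself makes it a seminorm on all functions. *)
Definition discrepancy (f : gT -> R) : R :=
  \sum_y `|f y - (\sum_z f z) / #|gT|%:R|.

Definition total_discrepancy (t : nat) (f : gT -> R) : R :=
  \sum_(s < t) discrepancy (iter s (step S) f).

Local Notation W := total_discrepancy.

Lemma total_discrepancyS t f : W t.+1 f = discrepancy f + W t (step S f).
Proof.
rewrite /W big_ord_recl; congr (_ + _).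
by apply: eq_bigr => i _; rewrite -iterSr.
Qed.

Lemma discrepancy_lin (a : R) f g : 0 <= a ->
  discrepancy (fun y => a * f y + g y) <= a * discrepancy f + discrepancy g.
Proof.
move=> a0; rewrite /discrepancy mulr_sumr -big_split /=.
apply: ler_sum => y _; rewrite big_split /= -mulr_sumr.
rewrite -[X in X * `|_|](ger0_norm a0) -normrM; apply: le_trans (ler_normD _ _).
by rewrite le_eqVlt; apply/orP; left; apply/eqP; congr `|_|; ring.
Qed.

(** The step is linear and each discrepancy is a seminorm. Thus a mixture costs at most the average
    cost of its components, which lets a recursion on the components replace a stopping time. *)
Lemma total_discrepancy_lin t (a : R) f g : 0 <= a ->
  W t (fun y => a * f y + g y) <= a * W t f + W t g.
Proof.
move=> a0; elim: t f g => [|t IH] f g.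
  by rewrite /W !big_ord0 mulr0 addr0.
rewrite !total_discrepancyS step_lin mulrDr addrACA.
by rewrite lerD ?discrepancy_lin ?IH.
Qed.

Hypothesis S_gt0 : (0 < #|S|)%N.

Lemma total_discrepancy_cst t (c : R) : W t (fun=> c) = 0.
Proof.
have step_c : step S (fun=> c) = fun=> c.
  apply/funext => y; rewrite stepE sumr_const -[_ *+ #|_|]mulr_natl; field.
  by rewrite pnatr_eq0 -lt0n.
elim: t => [|t IH]; first by rewrite /W big_ord0.
rewrite total_discrepancyS step_c IH addr0 /discrepancy big1 // => y _.
rewrite sumr_const -[_ *+ #|_|]mulr_natl mulrAC mulfV ?mul1r ?subrr ?normr0 //.
by rewrite pnatr_eq0 -lt0n; apply/card_gt0P; exists 1%g.
Qed.

Lemma total_discrepancy_sum t (I : Type) (r : seq I) (P : pred I)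
    (F : I -> gT -> R) (a : R) : 0 <= a ->
  W t (fun y => a * \sum_(i <- r | P i) F i y)
    <= a * \sum_(i <- r | P i) W t (F i).
Proof.
move=> a0; elim: r => [|i r IH].
  rewrite big_nil mulr0; under eq_fun do rewrite big_nil mulr0.
  by rewrite total_discrepancy_cst.
under eq_fun do rewrite big_cons.
rewrite big_cons; case: (P i) => //.
under eq_fun do rewrite mulrDr.
by rewrite mulrDr (le_trans (total_discrepancy_lin _ _ _ a0)) ?lerD.
Qed.

Lemma discrepancy_le2 f : (forall y, 0 <= f y) -> \sum_y f y = 1 ->
  discrepancy f <= 2.
Proof.
move=> f0 f1; rewrite /discrepancy f1 mul1r.
apply: (@le_trans _ _ (\sum_y (f y + #|gT|%:R^-1))).
  apply: ler_sum => y _; apply: le_trans (ler_normB _ _) _.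
  by rewrite !ger0_norm.
rewrite big_split /= f1 sumr_const -[_ *+ #|_|]mulr_natl mulfV //.
by rewrite pnatr_eq0 -lt0n; apply/card_gt0P; exists 1%g.
Qed.

Hypothesis S_gen : generates S.

Lemma sum_walk_law (x : gT) t : \sum_y walk_law R (cayley S) x t y = 1.
Proof.
rewrite walk_law_step; elim: t => [|t IH] /=; last by rewrite sum_step.
by rewrite (bigD1 x) //= eqxx big1 ?addr0 // => y; rewrite eq_sym => /negPf ->.
Qed.

Lemma tv_dist_walk_law (x : gT) t :
  tv_dist (walk_law R (cayley S) x t) (stationary R (cayley S)) =
  2^-1 * discrepancy (iter t (step S) (fun y => (x == y)%:R)).
Proof.
by rewrite /tv_dist /discrepancy stationary_cayley // -walk_law_step sum_walk_law mul1r.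
Qed.

(* If the discrepancies have sum at most C, then they cannot all exceed 1/2
   before time 2C + 1. *)
Lemma tmix_le (C : R) :
  (forall x t, W t (fun y => (x == y)%:R) <= C) ->
  (tmix R (cayley S) <= (2 * C + 1)%:E)%E.
Proof.
move=> WC; apply: bigmax_le => [|x _]; first exact: leNye.
have C0 : 0 <= C by have := WC x 0%N; rewrite /W big_ord0.
pose t := (Num.truncn (2 * C)).+1.
have [/existsP[s Hs]|/existsPn H] := boolP [exists s : 'I_t,
    discrepancy (iter s (step S) (fun y => (x == y)%:R)) <= 2^-1].
  apply: ge_ereal_inf; exists (s : nat)%:R%:E.
    exists (s : nat) => //=; rewrite tv_dist_walk_law; lra.
  rewrite lee_fin (@le_trans _ _ (Num.truncn (2 * C))%:R) //.
    by rewrite ler_nat -ltnS.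
  by rewrite (@le_trans _ _ (2 * C)) ?truncn_le ?mulr_ge0 ?lerDl.
have : \sum_(s < t) (2^-1 : R) <= W t (fun y => (x == y)%:R).
  by apply: ler_sum => s _; apply: ltW; rewrite ltNge.
rewrite sumr_const card_ord -[_ *+ t]mulr_natl => tW.
have := truncnS_gt (2 * C); rewrite -/t => tC.
exfalso; have := le_trans tW (WC x t); lra.
Qed.

End Discrepancy.

Lemma sum_inv_le_sqrt (R : realType) (m : nat) :
  \sum_(j < m) (j.+1%:R^-1 : R) <= 2 * Num.sqrt m%:R.
Proof.
elim: m => [|m IH]; first by rewrite big_ord0 mulr_ge0 ?sqrtr_ge0.
rewrite big_ord_recr /=; apply: le_trans (lerD IH (lexx _)) _.
set a := Num.sqrt m%:R; set b := Num.sqrt m.+1%:R.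
have a0 : 0 <= a by exact: sqrtr_ge0.
have b2 : b ^+ 2 = m.+1%:R by rewrite sqr_sqrtr.
have a2 : a ^+ 2 = m%:R by rewrite sqr_sqrtr.
have b1 : 1 <= b by rewrite -sqrtr1 ler_wsqrtr // ler1n.
have ab : a <= b by rewrite ler_wsqrtr // ler_nat.
rewrite -b2 -lerBrDl -mulrBr.
(* The increment 2(b - a) dominates 1/b^2, because 1 = (b - a)(b + a) and b + a <= 2b <= 2b^2. *)
have E : (b - a) * (b + a) = 1 by rewrite -subr_sqr b2 a2 -natr1; ring.
have b_gt0 : 0 < b by lra.
rewrite -div1r ler_pdivrMr ?exprn_gt0 // -[X in X <= _]E.
have -> : 2 * (b - a) * b ^+ 2 = (b - a) * (2 * b ^+ 2) by ring.
apply: ler_wpM2l; first by rewrite subr_ge0.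
rewrite expr2; nra.
Qed.

(** * Lower bound on the mixing time when a single generator moves v *)

Section LowerBound.
Variables (R : realType) (T : finType) (S : {set {perm T}}) (v : T) (s0 : {perm T}).
Hypotheses (T_gt1 : (1 < #|T|)%N) (S_gt0 : (0 < #|S|)%N) (S_gen : generates S).
Hypothesis S_fix : forall s, s \in S -> s v != v -> s = s0.

Let f t : {perm T} -> R := walk_law R (cayley S) 1%g t.

Let mass t : R := \sum_(g : {perm T} | g v == v) f t g.

Let mass_le1 t : mass t <= 1.
Proof.
rewrite -(sum_walk_law R S_gt0 1%g t) [leRHS](bigID (fun g : {perm T} => g v == v)) /=.
by rewrite lerDl sumr_ge0 // => y _; apply: walk_law_ge0.
Qed.

Let mass_ge t : 1 - t%:R / (2 * #|S|%:R) <= mass t.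
Proof.
elim: t => [|t IH].
  rewrite mul0r subr0 /mass /f /= (bigD1 1%g) /= ?perm1 ?eqxx // lerDl.
  by apply: sumr_ge0.
(* Only a draw of [s0], of probability 1/(2#|S|), can move v, so one step loses at most that much
   mass. For this draw the translated sum is bounded below by 0, and [mass t] above by 1. *)
suff H : mass t - (2 * #|S|%:R)^-1 <= mass t.+1.
  by rewrite -natr1 mulrDl mul1r; lra.
have -> : mass t.+1 = 2^-1 * mass t + (2 * #|S|%:R)^-1 *
    \sum_(s in S) \sum_(g : {perm T} | g v == v) f t (g * s^-1)%g.
  rewrite exchange_big /= /mass !mulr_sumr -big_split /=.
  by apply: eq_bigr => g _; rewrite [LHS](stepE S (f t)).
have shift s : s \in S ->
    mass t - (s == s0)%:R <= \sum_(g : {perm T} | g v == v) f t (g * s^-1)%g.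
  move=> sS; have [sv|/(S_fix sS) ->] := eqVneq (s v) v; last first.
    rewrite eqxx (@le_trans _ _ 0) ?subr_le0 ?mass_le1 //.
    by apply: sumr_ge0 => g _; apply: walk_law_ge0.
  have -> : \sum_(g : {perm T} | g v == v) f t (g * s^-1)%g = mass t.
    rewrite (reindex_inj (mulIg s)) /=; apply: eq_big => [g|g _]; last by rewrite mulgK.
    by rewrite permM -{2}sv (inj_eq perm_inj).
  by rewrite lerBlDr lerDl.
have H : \sum_(s in S) (mass t - (s == s0)%:R) <=
    \sum_(s in S) \sum_(g : {perm T} | g v == v) f t (g * s^-1)%g by exact: ler_sum.
rewrite sumrB sumr_const -[_ *+ #|_|]mulr_natl in H.
have one : \sum_(s in S) (s == s0)%:R <= 1 :> R.
  rewrite -natr_sum lern1 -big_mkcondr sum1_card /=.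
  by rewrite (leq_trans (subset_leq_card (B := pred1 s0) _)) ?card1 //;
     apply/fintype.subsetP => s /andP[].
have lam0 : 0 <= (2 * #|S|%:R)^-1 :> R by rewrite invr_ge0 mulr_ge0.
have Hl := ler_wpM2l lam0 (le_trans (lerB (lexx _) one) H).
have El : (2 * #|S|%:R)^-1 * (#|S|%:R * mass t - 1) =
    2^-1 * mass t - (2 * #|S|%:R)^-1 :> R.
  by field; rewrite pnatr_eq0 -lt0n.
lra.
Qed.

(** Right multiplication by (v w) injects the stabiliser of v into its complement. *)
Let card_fix : (#|[set g : {perm T} | g v == v]|.*2 <= #|{perm T}|)%N.
Proof.
have /card_gt0P[w] : (0 < #|[set~ v]|)%N by rewrite cardsC1; lia.
rewrite !inE => wv.
rewrite -addnn -(cardsC [set g : {perm T} | g v == v]) leq_add2l.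
rewrite -(card_imset _ (mulIg (tperm v w))) subset_leq_card //.
apply/fintype.subsetP => g /imsetP[k]; rewrite !inE => /eqP kv ->.
by rewrite permM kv tpermL.
Qed.

(** The event g v = v, of uniform probability at most 1/2, is the test event; it and its complement
    contribute equally to the L1 distance. *)
Let tv_ge t :
  mass t - 2^-1 <= tv_dist (walk_law R (cayley S) 1%g t) (stationary R (cayley S)).
Proof.
rewrite stationary_cayley // /tv_dist -/(f t).
set q : R := #|_|%:R^-1.
have q1 : \sum_(g : {perm T}) q = 1.
  rewrite sumr_const -[_ *+ #|_|]mulr_natl /q mulfV // pnatr_eq0 -lt0n.
  by apply/card_gt0P; exists 1%g.
have qE : \sum_(g : {perm T} | g v == v) q <= 2^-1.
  rewrite sumr_const -[_ *+ _]mulr_natl /q.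
  rewrite ler_pdivrMr ?ltr0n; last by apply/card_gt0P; exists 1%g.
  rewrite mulrC ler_pdivlMr // -natrM ler_nat muln2.
  by apply: leq_trans card_fix; rewrite leq_double cardsE.
have F1 : \sum_g f t g = 1 by exact: sum_walk_law.
rewrite (bigID (fun g : {perm T} => g v == v)) /= in F1 q1 *.
rewrite (bigID (fun g : {perm T} => g v == v)) /= in q1.
rewrite (bigID (fun g : {perm T} => g v == v)) /=.
set X := \sum_(_ | _) `|_|; set Y := \sum_(_ | _) `|_|.
have HX : \sum_(g : {perm T} | g v == v) (f t g - q) <= X.
  by apply: ler_sum => g _; apply: ler_norm.
have HY : \sum_(g : {perm T} | g v != v) (q - f t g) <= Y.
  by apply: ler_sum => g _; rewrite distrC ler_norm.
rewrite !sumrB in HX HY; rewrite /mass; lra.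
Qed.

(** At a time t at distance at most 1/4 from uniform, the mass is at most 3/4, while it is at least
    1 - t/(2#|S|). *)
Lemma tmix_ge : ((2^-1 * #|S|%:R)%:E <= tmix R (cayley S))%E.
Proof.
apply: le_trans (le_bigmax _ _ (1%g : {perm T})).
apply: le_ereal_inf_tmp => _ [t /= Ht <-]; rewrite lee_fin.
have := le_trans (tv_ge t) Ht; have := mass_ge t => H1 H2.
have : 4^-1 <= t%:R / (2 * #|S|%:R) :> R by lra.
rewrite ler_pdivlMr ?mulr_gt0 ?ltr0n //; lra.
Qed.

End LowerBound.

(** * The star transpositions and permutations supported on a set *)

Section Star.
Variables (T : finType) (h : T).

Definition star : {set {perm T}} := [set tperm h i | i in [set~ h]].

Lemma tperm_hub_inj : injective (tperm h).
Proof. by move=> i j eq_ij; rewrite -(tpermL h i) eq_ij tpermL. Qed.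

Lemma card_star : #|star| = #|T|.-1.
Proof. by rewrite card_imset ?cardsC1 //; apply: tperm_hub_inj. Qed.

Lemma generates_star : generates star.
Proof.
rewrite /generates -(gen_tperm h); apply/eqP; rewrite finset.eqEsubset !gen_subG.
apply/andP; split; apply/fintype.subsetP => s /imsetP[i ih ->].
  by apply/mem_gen/imset_f.
have [->|ih'] := eqVneq i h; first by rewrite tperm1 group1.
by apply/mem_gen/imset_f; rewrite !inE.
Qed.

Lemma perm_on_conj (A : {set T}) (w s : {perm T}) :
  perm_on (s @: A) (w ^ s)%g = perm_on A w.
Proof.
apply/fintype.subsetP/fintype.subsetP => [H x wx|H y].
  have := H (s x); rewrite !inE permJ (inj_eq perm_inj) (mem_imset _ _ perm_inj).
  by apply.
rewrite -(permKV s y) !inE permJ (inj_eq perm_inj) (mem_imset _ _ perm_inj) => wy.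
exact: H.
Qed.

Lemma perm_on_tpermr (A : {set T}) (w : {perm T}) (i : T) :
  h \in A -> i \in A -> perm_on A (w * tperm h i)%g = perm_on A w.
Proof.
move=> hA iA.
have on_t : perm_on A (tperm h i).
  apply: fintype.subset_trans (tperm_on h i) _.
  by apply/fintype.subsetP => x; rewrite !inE => /orP[]/eqP->.
apply/idP/idP => [H|H]; last exact: perm_onM.
by rewrite -(mulgK (tperm h i) w) tpermV perm_onM.
Qed.

(** This is the decomposition of Sym(h |: A) into the cosets Sym(A)(h i), where w lies in the coset
    of index i = w h. *)
Lemma perm_on_tperm_hub (A : {set T}) (w : {perm T}) (i : T) :
  h \notin A -> i \in h |: A ->
  perm_on A (w * tperm h i)%g = perm_on (h |: A) w && (i == w h).
Proof.
move=> hA iA; have hhA : h \in h |: A by rewrite !inE eqxx.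
apply/idP/andP => [on_wt|[on_w /eqP iw]].
  split.
    rewrite -(perm_on_tpermr w hhA iA).
    by apply: fintype.subset_trans on_wt _; apply: finset.subsetUr.
  have := out_perm on_wt hA; rewrite permM => E.
  by rewrite -[w h](tpermK h i) E tpermL.
rewrite -(perm_on_tpermr w hhA iA) in on_w.
apply/fintype.subsetP => x; rewrite !inE => wx.
have := fintype.subsetP on_w x; rewrite !inE => /(_ wx) /orP[/eqP xh|//].
by move: wx; rewrite xh permM -iw tpermR eqxx.
Qed.

Variable R : realType.

Local Notation step := (step (R := R) star).
Local Notation W := (total_discrepancy (R := R) star).

Lemma sum_star (F : {perm T} -> R) :
  \sum_(s in star) F s = \sum_(i | i != h) F (tperm h i).
Proof.
rewrite big_imset /=; last by move=> i j _ _; apply: tperm_hub_inj.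
by apply: eq_bigl => i; rewrite !inE.
Qed.

(** * Uniform laws on cosets and the effect of one step on them *)

Definition unif_coset (A : {set T}) (g y : {perm T}) : R :=
  (perm_on A (g^-1 * y)%g)%:R / (#|A| `!)%:R.

Local Notation u := unif_coset.

Lemma unif_coset_ge0 A g y : 0 <= u A g y.
Proof. by rewrite divr_ge0. Qed.

Lemma sum_unif_coset A g : \sum_y u A g y = 1.
Proof.
rewrite (reindex_inj (mulgI g)) -mulr_suml.
under eq_bigr do rewrite mulKg.
by rewrite -natr_sum -big_mkcond sum1_card card_perm mulfV // pnatr_eq0 -lt0n fact_gt0.
Qed.

Lemma unif_coset_set1 g : u [set h] g = fun y => (g == y)%:R.
Proof.
apply/funext => y; rewrite /u cards1 divr1; congr (_%:R); congr nat_of_bool.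
apply/idP/eqP => [|->]; last by rewrite mulVg perm_on1.
move=> /perm_on_id; rewrite cards1 => /(_ isT) E.
by rewrite -(mulKVg g y) E mulg1.
Qed.

(** With t = (h i), g Sym(A) t = g t Sym(t A), by conjugation. *)
Lemma unif_coset_shift (A : {set T}) g y (i : T) :
  u A g (y * tperm h i)%g = u (tperm h i @: A) (g * tperm h i)%g y.
Proof.
rewrite /u card_imset; last exact: perm_inj.
rewrite -(perm_on_conj _ _ (tperm h i)) /conjg tpermV invMg tpermV.
by rewrite -!mulgA tperm2 mulg1.
Qed.

Lemma sum_unif_coset_tperm (A : {set T}) g y : h \notin A ->
  \sum_(i in h |: A) u A g (y * tperm h i)%g = #|A|.+1%:R * u (h |: A) g y.
Proof.
move=> hA; have cA : #|h |: A| = #|A|.+1 by rewrite cardsU1 hA.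
rewrite /u cA factS natrM -mulr_suml.
have -> : \sum_(i in h |: A) (perm_on A (g^-1 * (y * tperm h i))%g)%:R =
    (perm_on (h |: A) (g^-1 * y)%g)%:R :> R.
  under eq_bigr => i iA do rewrite mulgA perm_on_tperm_hub //.
  have [on_w|] := boolP (perm_on _ _); last by rewrite big1.
  have wA : (g^-1 * y)%g h \in h |: A by rewrite perm_closed // !inE eqxx.
  rewrite (bigD1 _ wA) /= eqxx big1 ?addr0 // => i /andP[_ /negPf ->].
  by [].
by rewrite invfM mulrCA !mulrA mulfK // pnatr_eq0.
Qed.

Let lam : R := (2 * #|star|%:R)^-1.

Lemma step_unif_coset_mem (A : {set T}) g : h \in A ->
  step (u A g) = fun y => (2^-1 + lam * #|A|.-1%:R) * u A g y +
    lam * \sum_(i | i \notin A) u (tperm h i @: A) (g * tperm h i)%g y.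
Proof.
move=> hA; apply/funext => y; rewrite stepE sum_star -/lam.
under eq_bigr do rewrite tpermV.
rewrite (bigID (mem A)) /= mulrDl -addrA -mulrA -mulrDr.
congr (_ + lam * (_ + _)).
  rewrite (eq_bigr (fun=> u A g y)) => [|i /andP[_ iA]].
    rewrite sumr_const -[_ *+ #|_|]mulr_natl (cardsD1 h A) hA /=.
    by congr (_%:R * _); apply: eq_card => i; rewrite !inE.
  by rewrite /u mulgA perm_on_tpermr.
apply: eq_big => [i|i _]; last exact: unif_coset_shift.
by apply: andb_idl; apply: contraNneq => ->.
Qed.

(** The translates by (h i) for i in A average to the law on the larger coset only together with the
    term i = h, which is the identity. Its weight [lam] is taken from the holding probability,
    whence [2^-1 - lam]. *)
Lemma step_unif_coset_notin (A : {set T}) g : h \notin A ->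
  step (u A g) = fun y => (2^-1 - lam) * u A g y +
    (lam * #|A|.+1%:R * u (h |: A) g y +
     lam * \sum_(i | i \notin h |: A) u (tperm h i @: A) (g * tperm h i)%g y).
Proof.
move=> hA; apply/funext => y; rewrite stepE sum_star -/lam.
under eq_bigr do rewrite tpermV.
rewrite mulrBl -mulrA -(sum_unif_coset_tperm _ _ hA).
have hhA : h \in h |: A by rewrite !inE eqxx.
rewrite (bigD1 h hhA) /= tperm1 mulg1 (bigID (mem A)) /=.
have -> : \sum_(i | (i != h) && (i \in A)) u A g (y * tperm h i)%g =
    \sum_(i in h |: A | i != h) u A g (y * tperm h i)%g.
  by apply: eq_bigl => i; rewrite !inE [RHS]andbC; case: eqP.
have -> : \sum_(i | (i != h) && (i \notin A)) u A g (y * tperm h i)%g =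
    \sum_(i | i \notin h |: A) u (tperm h i @: A) (g * tperm h i)%g y.
  apply: eq_big => [i|i _]; last exact: unif_coset_shift.
  by rewrite !inE negb_or.
ring.
Qed.

(** * Upper bound on the mixing time of the star *)

Hypothesis T_gt1 : (1 < #|T|)%N.

Let n := #|T|.

Let star_gt0 : (0 < #|star|)%N.
Proof. by rewrite card_star; lia. Qed.

Let lam_gt0 : 0 < lam.
Proof. by rewrite invr_gt0 mulr_gt0 // ltr0n. Qed.

Let lamE : n%:R - 1 = (2 * lam)^-1.
Proof.
rewrite /lam invfM invrK mulrA mulVf // mul1r card_star -subn1 natrB //.
exact: ltnW.
Qed.

Let lam_le : lam <= 2^-1.
Proof.
by rewrite lef_pV2 ?posrE ?mulr_gt0 ?ltr0n // ler_peMr // ler1n.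
Qed.

Let W_step A g t : W t.+1 (u A g) <= 2 + W t (step (u A g)).
Proof.
rewrite total_discrepancyS lerD2r.
by rewrite discrepancy_le2 ?sum_unif_coset // => y; apply: unif_coset_ge0.
Qed.

Let shift_mem (A : {set T}) (i j : T) : (i \in tperm h j @: A) = (tperm h j i \in A).
Proof.
by rewrite -{1}(tpermK h j i) (mem_imset _ _ perm_inj).
Qed.

Let sum_notin (A : {set T}) (c : R) :
  \sum_(i | i \notin A) c = (n%:R - #|A|%:R) * c.
Proof.
rewrite (eq_bigl (mem (~: A))) => [|i]; last by rewrite /= inE.
by rewrite sumr_const -[_ *+ #|_|]mulr_natl cardsCs finset.setCK natrB // max_card.
Qed.

(** Each step costs at most 2, and A absorbs h with probability [lam * k], so the mean wait is
    1/([lam * k]). The remaining draws keep h outside a set of the same size, and induction on t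
    applies to them. *)
Let W_unif_notin (b : R) (k : nat) :
  (forall (A : {set T}) g t, h \in A -> #|A| = k -> W t (u A g) <= b) ->
  forall t (A : {set T}) g, h \notin A -> #|A|.+1 = k ->
    W t (u A g) <= 2 / (lam * k%:R) + b.
Proof.
move=> Hb; elim=> [|t IH] A g hA cA.
  rewrite /total_discrepancy big_ord0 addr_ge0 //.
    by rewrite divr_ge0 // mulr_ge0 // ltW.
  (* At time 0 the total is an empty sum, so the hypothesis yields 0 <= b. *)
  have := @Hb (h |: A) g 0%N; rewrite /total_discrepancy big_ord0; apply.
    by rewrite !inE eqxx.
  by rewrite cardsU1 hA.
set B := 2 / _ + _.
have cU : #|h |: A| = k by rewrite cardsU1 hA.
apply: le_trans (W_step _ _ _) _; rewrite step_unif_coset_notin //.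
have lam_half : 0 <= 2^-1 - lam by rewrite subr_ge0.
have lamk : 0 <= lam * #|A|.+1%:R by rewrite mulr_ge0 // ltW.
have H1 := total_discrepancy_lin star t (u A g) (fun y =>
  (lam * #|A|.+1%:R * u (h |: A) g y +
     lam * \sum_(i | i \notin h |: A) u (tperm h i @: A) (g * tperm h i)%g y)) lam_half.
have H2 := total_discrepancy_lin star t (u (h |: A) g) (fun y =>
     lam * \sum_(i | i \notin h |: A) u (tperm h i @: A) (g * tperm h i)%g y) lamk.
have H3 := total_discrepancy_sum star_gt0 t (index_enum T)
  (fun i => i \notin h |: A)
  (fun i => u (tperm h i @: A) (g * tperm h i)%g) (ltW lam_gt0).
have H4 : \sum_(i | i \notin h |: A)
    W t (u (tperm h i @: A) (g * tperm h i)%g) <= (n%:R - k%:R) * B.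
  apply: (@le_trans _ _ (\sum_(i | i \notin h |: A) B)).
    apply: ler_sum => i; rewrite !inE negb_or => /andP[_ iA].
    apply: IH; first by rewrite shift_mem tpermL.
    by rewrite card_imset //; apply: perm_inj.
  by rewrite sum_notin cU.
have H5 := IH A g hA cA.
have H6 : W t (u (h |: A) g) <= b by apply: Hb => //; rewrite !inE eqxx.
have EB : lam * k%:R * (B - b) = 2.
  by rewrite /B addrK mulrC divfK // mulf_neq0 ?gt_eqF // ltr0n -cA.
have En : lam * (n%:R - 1) = 2^-1.
  by rewrite lamE invfM mulrCA mulfV ?mulr1 ?gt_eqF.
have M1 := ler_wpM2l lam_half H5.
have M2 := ler_wpM2l lamk H6.
have M3 := ler_wpM2l (ltW lam_gt0) H4.
(* [B] is the fixed point of the one-step recursion: spending 2 and averaging the bounds on the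
   successors gives back [B]. *)
have EB' : (2^-1 - lam) * B + lam * k%:R * b + lam * ((n%:R - k%:R) * B) = B - 2.
  have -> : lam * ((n%:R - k%:R) * B) = (lam * (n%:R - 1) + lam - lam * k%:R) * B by ring.
  by rewrite En; lra.
rewrite -/B in M1; rewrite cA in H1 H2 M2 *.
lra.
Qed.

(** The same waiting-time argument: h leaves A upon a draw of one of the n - k points outside, at
    total rate [lam * (n - k)]. *)
Let W_unif_mem (b : R) (k : nat) : (k < n)%N ->
  (forall (A : {set T}) g t, h \notin A -> #|A| = k -> W t (u A g) <= b) ->
  forall t (A : {set T}) g, h \in A -> #|A| = k ->
    W t (u A g) <= 2 / (lam * (n%:R - k%:R)) + b.
Proof.
move=> k_lt Hb; elim=> [|t IH] A g hA cA.
  have nk : 0 < n%:R - k%:R :> R by rewrite subr_gt0 ltr_nat.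
  rewrite /total_discrepancy big_ord0 addr_ge0 //.
    by rewrite divr_ge0 // mulr_ge0 // ltW.
  have /fintype.subsetPn[i _ iA] : ~~ ([set: T] \subset A).
    by apply: contraL k_lt => /subset_leq_card; rewrite cardsT cA -leqNgt.
  have := @Hb (tperm h i @: A) g 0%N; rewrite /total_discrepancy big_ord0; apply.
    by rewrite shift_mem tpermL.
  by rewrite card_imset //; apply: perm_inj.
set B := 2 / _ + _.
apply: le_trans (W_step _ _ _) _; rewrite step_unif_coset_mem //.
have lamk : 0 <= 2^-1 + lam * #|A|.-1%:R by rewrite addr_ge0 // mulr_ge0 // ltW.
have H1 := total_discrepancy_lin star t (u A g) (fun y =>
  lam * \sum_(i | i \notin A) u (tperm h i @: A) (g * tperm h i)%g y) lamk.
have H3 := total_discrepancy_sum star_gt0 t (index_enum T)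
  (fun i => i \notin A)
  (fun i => u (tperm h i @: A) (g * tperm h i)%g) (ltW lam_gt0).
have H4 : \sum_(i | i \notin A)
    W t (u (tperm h i @: A) (g * tperm h i)%g) <= (n%:R - k%:R) * b.
  apply: (@le_trans _ _ (\sum_(i | i \notin A) b)).
    apply: ler_sum => i iA; apply: Hb; first by rewrite shift_mem tpermL.
    by rewrite card_imset //; apply: perm_inj.
  by rewrite sum_notin cA.
have M1 := ler_wpM2l lamk (IH A g hA cA).
have M3 := ler_wpM2l (ltW lam_gt0) H4.
have EB : lam * (n%:R - k%:R) * (B - b) = 2.
  rewrite /B addrK mulrC divfK // mulf_neq0 ?gt_eqF //.
  by rewrite subr_gt0 ltr_nat.
have En : lam * (n%:R - 1) = 2^-1.
  by rewrite lamE invfM mulrCA mulfV ?mulr1 ?gt_eqF.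
have k_gt0 : (0 < k)%N by rewrite -cA; apply/card_gt0P; exists h.
have Ek : #|A|.-1%:R = k%:R - 1 :> R by rewrite cA -subn1 natrB.
have EB' : (2^-1 + lam * #|A|.-1%:R) * B + lam * ((n%:R - k%:R) * b) = B - 2.
  have -> : 2^-1 + lam * #|A|.-1%:R = 1 - lam * (n%:R - k%:R) by rewrite Ek; lra.
  lra.
rewrite -/B in M1; lra.
Qed.

(** Twice the mean time to reach A = T when d points are missing. With j + 1 points missing, h
    leaves A at rate [lam * (j + 1)], then A grows at rate [lam * (n - j)]. *)
Let hit (d : nat) : R :=
  \sum_(j < d) (2 / lam * (j.+1%:R^-1 + (n - j)%:R^-1)).

Let W_unif_hit d t (A : {set T}) g :
  (d < n)%N -> h \in A -> #|A| = (n - d)%N -> W t (u A g) <= hit d.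
Proof.
elim: d t A g => [|d IH] t A g d_lt hA cA.
  have -> : A = [set: T].
    by apply/eqP; rewrite eqEcard finset.subsetT cardsT cA subn0 leqnn.
  rewrite /hit big_ord0.
  have -> : u [set: T] g = fun=> (#|T| `!)%:R^-1.
    apply/funext => y; rewrite /u cardsT.
    have -> : perm_on [set: T] (g^-1 * y)%g by apply/fintype.subsetP => z; rewrite !inE.
    by rewrite mul1r.
  by rewrite total_discrepancy_cst.
rewrite /hit big_ord_recr /= -/(hit d).
have Hn := @W_unif_notin (hit d) (n - d) (fun B g t => IH t B g (ltnW d_lt)).
have k_lt : (n - d.+1 < n)%N by lia.
apply: le_trans (@W_unif_mem (2 / (lam * (n - d)%:R) + hit d) _ k_lt _ t A g hA cA) _.
  by move=> B g' t' hB cB; apply: Hn => //; lia.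
rewrite [(n - d.+1)%:R]natrB ?(ltnW d_lt) //.
by rewrite subKr !invfM mulrDr !mulrA addrA addrC.
Qed.

Let tmix_star_hit : (tmix R (cayley star) <=
  (2 * \sum_(j < n.-1) (2 / lam * (j.+1%:R^-1 + (n - j)%:R^-1)) + 1)%:E)%E.
Proof.
apply: tmix_le => //; first exact: generates_star.
move=> x t; rewrite -unif_coset_set1; apply: W_unif_hit; first by rewrite /n; lia.
  by rewrite inE.
by rewrite cards1 /n; lia.
Qed.

Lemma tmix_star_le : (tmix R (cayley star) <= (33 * n%:R * Num.sqrt n%:R)%:E)%E.
Proof.
apply: le_trans tmix_star_hit _; rewrite lee_fin.
have sqrt1 : 1 <= Num.sqrt n%:R :> R by rewrite -[leLHS]sqrtr1 ler_wsqrtr // ler1n ltnW.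
have n1 : 1 <= n%:R :> R by rewrite ler1n ltnW.
have H1 : \sum_(j < n.-1) (j.+1%:R^-1 : R) <= 2 * Num.sqrt n%:R.
  apply: le_trans (sum_inv_le_sqrt _ _) _.
  by rewrite ler_pM2l // ler_wsqrtr // ler_nat leq_pred.
have H2 : \sum_(j < n.-1) ((n - j)%:R^-1 : R) <= 2 * Num.sqrt n%:R.
  (* Reversing the order turns n - j into j + 2. *)
  apply: le_trans H1; rewrite (reindex_inj rev_ord_inj) /=.
  apply: ler_sum => j _; rewrite lef_pV2 ?posrE ?ltr0n ?ler_nat //; have := ltn_ord j; lia.
have lamV : 2 / lam <= 4 * n%:R.
  rewrite /lam invrK mulrA -natrM ler_wpM2l // ler_nat card_star; exact: leq_pred.
have lamV0 : 0 <= 2 / lam by rewrite divr_ge0 // ltW.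
rewrite -mulr_sumr big_split /=.
set X := \sum_(_ < _) _ in H1 *; set Y := \sum_(_ < _) _ in H2 *.
have M1 : 2 / lam * (X + Y) <= 4 * n%:R * (4 * Num.sqrt n%:R).
  apply: le_trans (ler_wpM2l lamV0 (_ : _ <= 4 * Num.sqrt n%:R)) _; first by lra.
  by rewrite ler_wpM2r // mulr_ge0 // sqrtr_ge0.
(* The main term is 2 * 4 * 4 = 32 times n sqrt n, and the additional 1 is at most n sqrt n. *)
nra.
Qed.

End Star.

(** * Comparison of the word metrics *)

Lemma quasi_isometric_cayley (R : realType) (gT : finGroupType) (S S' : {set gT}) :
  S \subset S' -> S' \subset (S * S * S)%g ->
  quasi_isometric (gdist R (cayley S)) (gdist R (cayley S')) 3 0.
Proof.
move=> SS' S'S3.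
pose D (A : {set gT}) u v := [set (size p)%:R | p in
  [set p : seq gT | path (cayley A) u p /\ last u p = v]]%classic : set R.
have D_lb A u v : lbound (D A u v) 0 by move=> _ [p _ <-].
have D_hlb A u v : has_lbound (D A u v) by exists 0.
have gd A u v : gdist R (cayley A) u v = inf (D A u v) by [].
have sub u v : (D S u v `<=` D S' u v)%classic.
  move=> _ [p [pp pl] <-]; exists p => //; split=> //.
  apply: sub_path pp => x y; rewrite !cayleyE; exact: (fintype.subsetP SS').
have expand u v r : D S' u v r -> D S u v (3 * r).
  case=> p [pp pl] <-; rewrite -natrM.
  suff [q [qp ql qs]] : exists q,
      [/\ path (cayley S) u q, last u q = v & size q = (3 * size p)%N].
    by exists q => //; rewrite qs.
  elim: p u pp pl => [|x p IH] u /=; first by exists [::].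
  case/andP=> ux pp pl; have [q [qp ql qs]] := IH x pp pl.
  move: ux; rewrite cayleyE => /(fintype.subsetP S'S3).
  case/mulsgP => ab c /mulsgP[a b aS bS ->] cS E.
  exists [:: (u * a)%g, (u * a * b)%g, x & q]; split=> //=; last by rewrite qs; lia.
  rewrite qp !cayleyE !mulKg aS bS /= andbT.
  have -> : x = (u * a * b * c)%g by rewrite -(mulKVg u x) E !mulgA.
  by rewrite mulKg.
(* The identity works: an S-path is an S'-path, and an S'-edge expands into three S-edges, so d' <=
   d <= 3d'. *)
exists id; split=> [u v|y]; last first.
  exists y; rewrite gd addr0; apply: (@le_trans _ _ 0) => //.
  by apply: ge_inf => //; exists [::].
rewrite subr0 addr0 !gd.
have [[r Dr]|D'0] := pselect (exists r, D S' u v r).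
  have DS := expand _ _ _ Dr; apply/andP; split.
    apply: lb_le_inf; first by exists r.
    move=> s /expand Ds; rewrite ler_pdivrMr // mulrC.
    exact: (ge_inf (D_hlb S u v)).
  have inf0_le : 0 <= inf (D S u v) by apply: lb_le_inf (D_lb S u v); exists (3 * r).
  apply: (@le_trans _ _ (inf (D S u v))); last by rewrite ler_peMl // ler1n.
  apply: lb_le_inf; first by exists (3 * r).
  move=> s /sub; exact: (ge_inf (D_hlb S' u v)).
(* Without an S'-path there is no S-path either, and both distances take the default value 0 of the
   infimum of the empty set. *)
have empty A : (D A u v `<=` D S' u v)%classic -> D A u v = set0.
  by move=> AS'; apply/seteqP; split=> // r /AS' H; case: D'0; exists r.
by rewrite (empty S (sub u v)) (empty S' (fun=> id)) inf0 mul0r mulr0 lexx.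
Qed.

(** * The enlarged set of transpositions *)

Section StarClique.
Variables (T : finType) (h v : T).
Hypothesis hv : h != v.

Definition star_clique : {set {perm T}} :=
  star h :|: [set tperm i j | i in [set~ v], j in [set~ v] & i != j].

Lemma transposition_star s : s \in star h -> transposition s.
Proof.
by case/imsetP => i; rewrite !inE => ih ->; exists h, i; rewrite eq_sym.
Qed.

Lemma transposition_star_clique s : s \in star_clique -> transposition s.
Proof.
case/setUP => [|/imset2P[i j _]]; first exact: transposition_star.
by rewrite !inE => /andP[_ ij] ->; exists i, j.
Qed.

Lemma generates_star_clique : generates star_clique.
Proof.
apply/eqP; rewrite finset.eqEsubset finset.subsetT /= -(generates_star h).
exact/genS/finset.subsetUl.
Qed.

Lemma star_clique_sub : star_clique \subset (star h * star h * star h)%g.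
Proof.
have cube a b c : a \in star h -> b \in star h -> c \in star h ->
    (a * b * c)%g \in (star h * star h * star h)%g.
  by move=> ? ? ?; rewrite !mem_mulg.
have mem_star i : i != h -> tperm h i \in star h.
  by move=> ih; apply/imset_f; rewrite !inE.
(* A transposition is its own cube. *)
have star_sub s : s \in star h -> s \in (star h * star h * star h)%g.
  move=> sS; have [i _ si] := imsetP sS.
  by have := cube s s s sS sS sS; rewrite {2 3}si -mulgA tperm2 mulg1.
apply/fintype.subsetP => s /setUP[/star_sub//|/imset2P[i j _ /setIdP[_ ij] ->]].
have [ih|ih] := eqVneq i h.
  by rewrite ih; apply/star_sub/mem_star; rewrite -ih eq_sym.
have [jh|jh] := eqVneq j h.
  by rewrite jh tpermC; apply/star_sub/mem_star.
have -> : tperm i j = (tperm h i * tperm h j * tperm h i)%g.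
  rewrite -{1}(tpermV h i) -mulgA -/(conjg _ _) tpermJ tpermL.
  by rewrite tpermD // eq_sym.
by apply: cube; apply: mem_star.
Qed.

Lemma star_clique_fix s : s \in star_clique -> s v != v -> s = tperm h v.
Proof.
case/setUP => [/imsetP[i _ ->]|/imset2P[i j]].
  by case: tpermP => [/eqP|->//|]; rewrite ?eqxx // eq_sym (negPf hv).
rewrite !inE => iv /andP[jv _] ->.
by rewrite tpermD ?eqxx.
Qed.

(** The supports of the elements of [star_clique] include all pairs of points other than v. *)
Lemma card_star_clique : ('C(#|T|.-1, 2) <= #|star_clique|)%N.
Proof.
rewrite -(cardsC1 v) -cards_draws.
apply: leq_trans (leq_imset_card (fun s : {perm T} => [set x | s x != x]%SET) _).
apply/subset_leq_card/fintype.subsetP => A; rewrite inE => /andP[Av].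
case/cards2P => i [j] [ij AE]; apply/imsetP; exists (tperm i j).
  apply/setUP; right; apply/imset2P; exists i j => //.
    by apply: (fintype.subsetP Av); rewrite AE !inE eqxx.
  rewrite inE ij andbT.
  by apply: (fintype.subsetP Av); rewrite AE !inE eqxx orbT.
rewrite AE; apply/setP => x; rewrite !inE.
case: tpermP => [->|->|/eqP/negPf-> /eqP/negPf->]; last by rewrite eqxx.
  by rewrite eqxx [j == i]eq_sym ij.
by rewrite eqxx orbT ij.
Qed.

End StarClique.

(** * The iterated logarithm and the conclusion *)

Lemma ln_ln_ln_fact_le (R : realType) (n : nat) : (0 < n)%N ->
  ln (ln (ln (n `!)%:R)) <= 4 * Num.sqrt n%:R :> R.
Proof.
move=> n_gt0; have n0 : 0 < n%:R :> R by rewrite ltr0n.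
have s0 : 0 < Num.sqrt n%:R :> R by rewrite sqrtr_gt0.
have ln_le (x b : R) : 0 <= b -> x <= b -> ln x <= b.
  move=> b0 xb; have [x0|x0] := leP x 0; first by rewrite ln0.
  exact: le_trans (ltW (ln_sublinear x0)) xb.
have b0 : 0 <= 4 * Num.sqrt n%:R :> R by rewrite mulr_ge0 // ltW.
(* The outer logarithm is dropped by ln x <= x. Nonpositive arguments, possible for small n, have
   logarithm 0 by convention. *)
apply: (ln_le _ _ b0).
have [L0|L0] := leP (ln (n `!)%:R) (0 : R); first by rewrite ln0.
have fact_le : (n `! <= n ^ n)%N.
  have H k : (k <= n -> k `! <= n ^ k)%N.
    by elim: k => // k IH kn; rewrite factS expnS leq_mul // IH // ltnW.
  exact: H.
have L_le : ln (n `!)%:R <= n%:R ^+ 2 :> R.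
  apply: (@le_trans _ _ (ln (n%:R ^+ n))).
    by rewrite ler_ln ?posrE ?exprn_gt0 ?ltr0n ?fact_gt0 // -natrX ler_nat.
  rewrite lnXn // -[ln _ *+ _]mulr_natl expr2 ler_pM2l //.
  exact/ltW/ln_sublinear.
apply: (@le_trans _ _ (ln (n%:R ^+ 2))).
  by rewrite ler_ln ?posrE ?exprn_gt0.
(* Writing n^2 as a fourth power of sqrt n gives ln(n^2) = 4 ln(sqrt n) <= 4 sqrt n. *)
have -> : n%:R ^+ 2 = Num.sqrt n%:R ^+ 4 :> R.
  by rewrite -[n%:R in LHS]sqr_sqrtr ?ltW // -exprM.
rewrite lnXn // -[ln _ *+ _]mulr_natl ler_pM2l //; exact/ltW/ln_sublinear.
Qed.

Lemma tmix_ge0 (R : realType) (gT : finGroupType) (S : {set gT}) :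
  (0 <= tmix R (cayley S))%E.
Proof.
apply: le_trans (le_bigmax _ _ (1%g : gT)).
by apply: le_ereal_inf_tmp => _ [t _ <-]; rewrite lee_fin.
Qed.

Definition star_set (n : nat) : {set 'S_n} :=
  if n is _.+2 then star ord0 else finset.set0.

Definition star_clique_set (n : nat) : {set 'S_n} :=
  if n is _.+2 then star_clique ord0 ord_max else finset.set0.

Theorem theorem1 (R : realType) :
  exists (c : R) (N0 : nat) (S S' : forall n : nat, {set 'S_n}),
    0 < c /\
    forall n : nat, (N0 <= n)%N ->
      (forall s, s \in S n -> transposition s) /\
      (forall s, s \in S' n -> transposition s) /\
      generates (S n) /\
      generates (S' n) /\
      quasi_isometric (gdist R (cayley (S n))) (gdist R (cayley (S' n))) 3 0 /\
      (c%:E * tmix R (cayley (S n)) * (ln (ln (ln #|[set: 'S_n]|%:R)))%:E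
         <= tmix R (cayley (S' n)))%E /\
      S n \subset S' n /\
      S' n \subset (S n * S n * S n)%g.
Proof.
(* The factors 33 and 4 come from [tmix_star_le] and [ln_ln_ln_fact_le]; the product of the two
   bounds with c is then n^2/16. *)
have [c c_gt0 cE] : exists2 c : R, 0 < c & c * 33 * 4 = 16^-1.
  by exists (16^-1 / 4 / 33); [rewrite !divr_gt0 ?invr_gt0 // ltr0n | rewrite !divfK // pnatr_eq0].
exists c, 4%N, star_set, star_clique_set; split; first exact: c_gt0.
case=> [|[|m]] //= m_ge.
set n := m.+2; set h : 'I_n := ord0; set v : 'I_n := ord_max.
have SS' : star h \subset star_clique h v by exact: finset.subsetUl.
have S'S := star_clique_sub h v.
split; first exact: transposition_star.
split; first exact: transposition_star_clique.
split; first exact: generates_star.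
split; first exact: generates_star_clique.
split; first exact: quasi_isometric_cayley.
split=> //.
have n_gt1 : (1 < #|'I_n|)%N by rewrite card_ord.
have S'_gt0 : (0 < #|star_clique h v|)%N.
  by apply: leq_trans (subset_leq_card SS'); rewrite card_star card_ord.
have lower := tmix_ge R n_gt1 S'_gt0 (generates_star_clique h v)
  (@star_clique_fix _ h v isT).
have upper := tmix_star_le h R n_gt1.
have c0 : (0 <= c%:E)%E by rewrite lee_fin ltW.
have L := ln_ln_ln_fact_le R (ltn0Sn m.+1).
rewrite cardsT card_Sn.
have s4_ge0 : (0 <= (4 * Num.sqrt n%:R : R)%:E)%E by rewrite lee_fin mulr_ge0 ?sqrtr_ge0.
apply: (@le_trans _ _ (c%:E * tmix R (cayley (star h)) * (4 * Num.sqrt n%:R)%:E)%E).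
  by apply: lee_wpmul2l; [exact: mule_ge0 c0 (tmix_ge0 _ _) | rewrite lee_fin].
apply: le_trans (lee_wpmul2r s4_ge0 (lee_wpmul2l c0 upper)) _.
apply: le_trans lower.
rewrite -!EFinM lee_fin card_ord.
have sq : Num.sqrt n%:R ^+ 2 = n%:R :> R by rewrite sqr_sqrtr.
have C2 : 2 * #|star_clique h v|%:R >= (n%:R - 1) * (n%:R - 2) :> R.
  have := card_star_clique h v; rewrite card_ord -(ler_nat R) => H.
  apply: le_trans (ler_wpM2l _ H) => //.
  rewrite -natrM -mul_bin_diag bin1 natrM /n -!natr1; lra.
have n4 : 4 <= n%:R :> R by rewrite ler_nat.
set x : R := n%:R in sq C2 n4 *; set s := Num.sqrt x in sq *.
have -> : c * (33 * x * s) * (4 * s) = 16^-1 * x ^+ 2.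
  by rewrite -cE -sq; ring.
(* It remains that n^2/16 <= (n - 1)(n - 2)/4, which holds from n = 4 on and fails at n = 3; hence
   the choice of N0. *)
nra.
Qed.
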